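(* For all integers $n \geq 0$, the following congruences hold: (1) $\overline{p}(11(8n+5)) \equiv 0 \pmod{11}$; (2) $\overline{p}(13\cdot 2^6(8n+7)) \equiv 0 \pmod{13}$.
   Context: For a positive integer $n$, an overpartition of $n$ is a nonincreasing sequence of positive integers summing to $n$ in which the first occurrence of each distinct part may be overlined. $\overline{p}(n)$ denotes the number of overpartitions of $n$ (with $\overline{p}(0)=1$); equivalently, $\sum_{n\ge 0}\overline{p}(n)q^n = \prod_{k\ge 1}\frac{1+q^k}{1-q^k}$. *)

(* Defs.v *)
From mathcomp Require Import all_boot.
Set Implicit Arguments. Unset Strict Implicit. Unset Printing Implicit Defensive.

(* An overpartition of n is represented as a sequence of (part, overlined?)
   pairs: parts are positive, nonincreasing, sum to n, and only the first
   occurrence of each distinct part may carry the overline flag. *)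

Definition parts_pos (s : seq (nat * bool)) : bool := all (fun x => 0 < x.1) s.

Definition parts_noninc (s : seq (nat * bool)) : bool :=
  sorted (fun x y : nat * bool => y.1 <= x.1) s.

(* only first occurrence of a part may be overlined: an overlined entry
   must have a predecessor with a different (hence larger) part, or none *)
Fixpoint first_occ_ok (prev : option nat) (s : seq (nat * bool)) : bool :=
  match s with
  | [::] => true
  | x :: s' =>
      (if x.2 then (if prev is Some p then p != x.1 else true) else true)
      && first_occ_ok (Some x.1) s'
  end.

Definition is_overpartition (n : nat) (s : seq (nat * bool)) : bool :=
  [&& parts_pos s, parts_noninc s, first_occ_ok None s &
      sumn (map fst s) == n].

Fixpoint cands (n k : nat) : seq (seq (nat * bool)) :=
  match k with
  | 0 => [:: [::]]
  | k'.+1 => [seq x :: s | x <- [seq (a, b) | a <- iota 1 n, b <- [:: false; true]],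
                           s <- cands n k']
  end.

(* candidate overpartitions of n: any overpartition has at most n parts,
   each at most n *)
Definition all_cands (n : nat) : seq (seq (nat * bool)) :=
  flatten [seq cands n k | k <- iota 0 n.+1].

Definition overpartn (n : nat) : nat :=
  count (is_overpartition n) (undup (all_cands n)).

Lemma overpartn_small : map overpartn (iota 0 5) = [:: 1; 2; 4; 8; 14].
Proof. by vm_compute. Qed.

(* Main.v *)
Require Import Defs.
From mathcomp Require Import all_boot.
From HB Require Import structures.
From mathcomp Require Import all_algebra finfield boolp.
From mathcomp Require Import ring zify.
Set Implicit Arguments. Unset Strict Implicit. Unset Printing Implicit Defensive.
Import GRing.Theory Num.Theory.

(* Let a(q) = \sum_j q^(j^2), b(q) = a(-q), X = a^4, Y = b^4 and D = q d/dq.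
   Gauss' identity says that the overpartition series P equals 1/b.  The
   arithmetic-geometric mean relations a b = b(q^2)^2 and
   a^2 + b^2 = 2 a(q^2)^2 follow from (c, d) |-> (c + d, c - d) on pairs of
   integers.  They drive everything else, because they turn the desired
   identities into functional equations between f(q) and f(q^2) that have a
   unique solution:
   - 4 (b Da - a Db) = a b (X - Y);
   - for p = 11, 13, the supersingular (Hasse) polynomial h satisfies
     h(X, Y) = 1 mod p, since h(X, Y) is invariant under q |-> q^2 and hence
     constant.
   Together they express Da/a and Db/b mod p as polynomials in X and Y, so
   b^(p-1) - D^(p-1) b^(p-1) can be computed.  It is the p-th power of
   b^6 (2 X - Y) for p = 11 and of b^4 (Y^2 + 10 X Y + 3 X^2) for p = 13, whence
     \sum_n P_(11 n) q^n = b^5 (2 X - Y)  mod 11,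
     \sum_n P_(13 n) q^n = b^3 (Y^2 + 10 X Y + 3 X^2)  mod 13.
   Finally a = x + y and b = x - y, where x = a(q^4), y only has exponents
   = 1 mod 8 and y^4 = X(q^4) - Y(q^4).  Hence extracting the exponents
   divisible by 4 preserves the forms a^3 t(X, Y) and b^3 t(X, Y), and
   x^4 (x^4 - y^4) = b(q^8)^8 kills the remaining residue classes mod 8. *)

(** * Formal power series *)

Record fps (R : comNzRingType) := Fps { fps_coef :> nat -> R }.

HB.instance Definition _ (R : comNzRingType) := gen_eqMixin (fps R).
HB.instance Definition _ (R : comNzRingType) := gen_choiceMixin (fps R).

Section FpsRing.
Local Open Scope ring_scope.
Variable R : comNzRingType.
Implicit Types (f g h : fps R) (p q : {poly R}).

Lemma fpsP f g : f =1 g -> f = g.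
Proof. by case: f g => f [g] /= /funext ->. Qed.

Definition fps_zero : fps R := Fps (fun=> 0).
Definition fps_opp f : fps R := Fps (fun n => - f n).
Definition fps_add f g : fps R := Fps (fun n => f n + g n).
Definition fps_one : fps R := Fps (fun n => (n == 0%N)%:R).
Definition fps_mul f g : fps R := Fps (fun n => \sum_(i < n.+1) f i * g (n - i)%N).

Lemma fps_addA : associative fps_add.
Proof. by move=> f g h; apply: fpsP => n; rewrite /= addrA. Qed.
Lemma fps_addC : commutative fps_add.
Proof. by move=> f g; apply: fpsP => n; rewrite /= addrC. Qed.
Lemma fps_add0 : left_id fps_zero fps_add.
Proof. by move=> f; apply: fpsP => n; rewrite /= add0r. Qed.
Lemma fps_addN : left_inverse fps_zero fps_opp fps_add.
Proof. by move=> f; apply: fpsP => n; rewrite /= addNr. Qed.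

HB.instance Definition _ :=
  GRing.isZmodule.Build (fps R) fps_addA fps_addC fps_add0 fps_addN.

Definition fps_trunc n f : {poly R} := \poly_(i < n.+1) f i.

Definition fps_agree N f p := forall n, (n <= N)%N -> f n = p`_n.

Lemma fps_agree_trunc N f : fps_agree N f (fps_trunc N f).
Proof. by move=> n le_nN; rewrite coef_poly ltnS le_nN. Qed.

(** A product up to degree [N] only involves its factors up to degree [N], so ring laws, dilation
    and Frobenius are inherited from truncations in [{poly R}]. *)
Lemma fps_agree_mul N f g p q :
  fps_agree N f p -> fps_agree N g q -> fps_agree N (fps_mul f g) (p * q).
Proof.
move=> fp gq n le_nN; rewrite coefM; apply: eq_bigr => i _.
have le_in : (i <= n)%N by rewrite -ltnS.
by rewrite fp ?gq // ?(leq_trans (leq_subr _ _) le_nN) // (leq_trans le_in).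
Qed.

Lemma fps_mulA : associative fps_mul.
Proof.
move=> f g h; apply: fpsP => n.
have F := @fps_agree_trunc n f; have G := @fps_agree_trunc n g; have H := @fps_agree_trunc n h.
rewrite (fps_agree_mul F (fps_agree_mul G H)) //.
by rewrite (fps_agree_mul (fps_agree_mul F G) H) // mulrA.
Qed.
Lemma fps_mulC : commutative fps_mul.
Proof.
move=> f g; apply: fpsP => n.
have F := @fps_agree_trunc n f; have G := @fps_agree_trunc n g.
by rewrite (fps_agree_mul F G) // (fps_agree_mul G F) // mulrC.
Qed.
Lemma fps_mul1 : left_id fps_one fps_mul.
Proof.
move=> f; apply: fpsP => n /=.
by rewrite big_ord_recl /= mul1r subn0 big1 ?addr0 // => i _; rewrite mul0r.
Qed.
Lemma fps_mulDl : left_distributive fps_mul fps_add.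
Proof.
move=> f g h; apply: fpsP => n /=; rewrite -big_split /=.
by apply: eq_bigr => i _; rewrite mulrDl.
Qed.
Lemma fps_oner_neq0 : fps_one != fps_zero.
Proof. by apply/eqP => /(congr1 (fun f : fps R => f 0%N)) /= /eqP; rewrite oner_eq0. Qed.

HB.instance Definition _ := GRing.Zmodule_isComNzRing.Build (fps R)
  fps_mulA fps_mulC fps_mul1 fps_mulDl fps_oner_neq0.

Lemma fpsD f g n : (f + g) n = f n + g n. Proof. by []. Qed.
Lemma fpsN f n : (- f) n = - f n. Proof. by []. Qed.
Lemma fps0 n : (0 : fps R) n = 0. Proof. by []. Qed.
Lemma fps1 n : (1 : fps R) n = (n == 0%N)%:R. Proof. by []. Qed.
Lemma fpsM f g n : (f * g) n = \sum_(i < n.+1) f i * g (n - i)%N. Proof. by []. Qed.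
Lemma fpsM0 f g : (f * g) 0%N = f 0%N * g 0%N.
Proof. by rewrite fpsM big_ord1 subn0. Qed.
Lemma fpsX0 f k : (f ^+ k) 0%N = f 0%N ^+ k.
Proof. by elim: k => [|k IH]; rewrite ?expr0 // !exprS fpsM0 IH. Qed.
Lemma fps_sum (I : Type) (r : seq I) (P : pred I) (F : I -> fps R) n :
  (\sum_(i <- r | P i) F i) n = \sum_(i <- r | P i) F i n.
Proof. by elim/big_rec2: _ => // i _ y _ <-. Qed.
Lemma fps_nat k n : (k%:R : fps R) n = k%:R * (n == 0%N)%:R.
Proof. by elim: k => [|k IH]; rewrite ?mul0r // !mulrS fpsD IH mulrDl mul1r. Qed.
Lemma fps_natM k f n : (k%:R * f) n = k%:R * f n.
Proof. by elim: k => [|k IH]; rewrite ?mul0r ?fps0 // !mulrS !mulrDl !mul1r fpsD IH. Qed.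

Lemma fps_agreeX N f p k : fps_agree N f p -> fps_agree N (f ^+ k) (p ^+ k).
Proof.
move=> fp; elim: k => [|k IH]; last by rewrite !exprS; apply: fps_agree_mul.
by move=> n _; rewrite !expr0 coef1.
Qed.

Definition fps_X k : fps R := Fps (fun n => (n == k)%:R).

Lemma fps_XM k f n : (fps_X k * f) n = if (k <= n)%N then f (n - k)%N else 0.
Proof.
rewrite fpsM; case: ifP => [le_kn|gt_kn].
  rewrite (bigD1 (Ordinal (le_kn : (k < n.+1)%N))) //= eqxx mul1r big1 ?addr0 //.
  by move=> i; rewrite -val_eqE /= => /negPf->; rewrite mul0r.
rewrite big1 // => i _ /=; case: eqP => [ik|_]; last by rewrite mul0r.
by have := ltn_ord i; rewrite ik ltnS gt_kn.
Qed.

Lemma fps_X0 : fps_X 0 = 1. Proof. exact: fpsP. Qed.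

Lemma fps_XD j k : fps_X (j + k) = fps_X j * fps_X k.
Proof.
apply: fpsP => n; rewrite fps_XM /=; case: leqP => [le_jn|lt_nj].
  by congr (nat_of_bool _)%:R; lia.
by case: eqP => // E; lia.
Qed.

(** In the coefficient of index [n], the constant term 1 of [f] isolates [g n]; the remaining terms
    agree by strong induction. *)
Lemma fps_cancel (f : fps R) g h : f 0%N = 1 -> f * g = f * h -> g = h.
Proof.
move=> f0 fgh; apply: fpsP; elim/ltn_ind=> n IH.
have := congr1 (fun u : fps R => u n) fgh.
rewrite !fpsM !big_ord_recl /= !f0 !mul1r !subn0.
have -> : \sum_(i < n) f (bump 0 i) * g (n - bump 0 i)%N =
          \sum_(i < n) f (bump 0 i) * h (n - bump 0 i)%N.
  by apply: eq_bigr => i _; rewrite IH // /bump /= add1n; have := ltn_ord i; lia.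
exact: addIr.
Qed.

(** The substitution q |-> q^k. *)
Definition fps_dil k f : fps R := Fps (fun n => if (k %| n)%N then f (n %/ k)%N else 0).

Lemma fps_dilE k f n : fps_dil k f n = if (k %| n)%N then f (n %/ k)%N else 0.
Proof. by []. Qed.

Lemma fps_dil_poly k f N : (0 < k)%N ->
  fps_agree N (fps_dil k f) (fps_trunc N f \Po 'X^k).
Proof.
move=> k_gt0 n le_nN /=; rewrite coef_comp_poly_Xn //; case: ifP => // _.
by rewrite -fps_agree_trunc // (leq_trans _ le_nN) // leq_div.
Qed.

Lemma fps_dilM k f g : (0 < k)%N -> fps_dil k (f * g) = fps_dil k f * fps_dil k g.
Proof.
move=> k_gt0; apply: fpsP => n.
rewrite (fps_agree_mul (@fps_dil_poly k f n k_gt0) (@fps_dil_poly k g n k_gt0)) //.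
rewrite -comp_polyM coef_comp_poly_Xn //= ; case: ifP => // k_n.
apply: (fps_agree_mul (@fps_agree_trunc n f) (@fps_agree_trunc n g)).
exact: leq_div.
Qed.
Lemma fps_dilD k f g : fps_dil k (f + g) = fps_dil k f + fps_dil k g.
Proof. by apply: fpsP => n; rewrite fpsD /=; case: ifP; rewrite ?addr0. Qed.
Lemma fps_dilN k f : fps_dil k (- f) = - fps_dil k f.
Proof. by apply: fpsP => n; rewrite fpsN /=; case: ifP; rewrite ?oppr0. Qed.
Lemma fps_dil1 k : (0 < k)%N -> fps_dil k 1 = 1.
Proof.
move=> k_gt0; apply: fpsP => n; rewrite fps1 /=; case: ifP => [/dvdnP[m ->]|].
  by rewrite mulnK // muln_eq0 (gtn_eqF k_gt0) orbF.
by case: n => // ; rewrite dvdn0.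
Qed.
Lemma fps_dilX k f j : (0 < k)%N -> fps_dil k (f ^+ j) = fps_dil k f ^+ j.
Proof. by move=> k0; elim: j => [|j IH]; rewrite ?fps_dil1 // !exprS fps_dilM // IH. Qed.
Lemma fps_dil_nat k j : (0 < k)%N -> fps_dil k j%:R = j%:R.
Proof.
by move=> k0; elim: j => [|j IH]; [apply: fpsP => n /=; case: ifP
  | rewrite !mulrS fps_dilD fps_dil1 // IH].
Qed.
Lemma fps_dil_dil j k f : (0 < j)%N -> (0 < k)%N ->
  fps_dil j (fps_dil k f) = fps_dil (j * k) f.
Proof.
move=> j0 k0; apply: fpsP => n /=; case: (boolP (j %| n)%N) => [/dvdnP[m ->]|jn].
  by rewrite mulnK // [(m * j)%N]mulnC dvdn_pmul2l // divnMl.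
by case: ifP => // /(dvdn_trans (dvdn_mulr k (dvdnn j))); rewrite (negPf jn).
Qed.
Lemma fps_dil_mul k f n : (0 < k)%N -> fps_dil k f (k * n)%N = f n.
Proof. by move=> k0 /=; rewrite dvdn_mulr // mulKn. Qed.

(** The operator D = q d/dq, which leaves exponents in place. *)
Definition fps_der f : fps R := Fps (fun n => n%:R * f n).

Lemma fps_derE f n : fps_der f n = n%:R * f n. Proof. by []. Qed.
Lemma fps_derD f g : fps_der (f + g) = fps_der f + fps_der g.
Proof. by apply: fpsP => n; rewrite fpsD /= mulrDr. Qed.
Lemma fps_derM f g : fps_der (f * g) = fps_der f * g + f * fps_der g.
Proof.
apply: fpsP => n; rewrite fpsD /= mulr_sumr -big_split /=.
apply: eq_bigr => i _; have le_in : (i <= n)%N by rewrite -ltnS.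
by rewrite -{1}(subnKC le_in) natrD; ring.
Qed.
Lemma fps_der1 : fps_der 1 = 0.
Proof. by apply: fpsP => n; rewrite /= ; case: n => [|n]; rewrite ?mul0r ?mulr0. Qed.
Lemma fps_derX f k : fps_der (f ^+ k.+1) = k.+1%:R * f ^+ k * fps_der f.
Proof.
elim: k => [|k IH]; first by rewrite !expr1 expr0 !mul1r.
by rewrite exprS fps_derM IH !exprS [in RHS]mulrS; ring.
Qed.
Lemma fps_der_nat k : fps_der k%:R = 0.
Proof.
apply: fpsP => n; rewrite /= fps_nat.
by case: n => [|n]; rewrite ?mul0r ?mulr0.
Qed.
Lemma fps_der_dil k f : (0 < k)%N -> fps_der (fps_dil k f) = k%:R * fps_dil k (fps_der f).
Proof.
move=> k0; apply: fpsP => n; rewrite fps_natM /=; case: ifP => [/dvdnP[m ->]|_].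
  by rewrite mulnK // natrM; ring.
by rewrite !mulr0.
Qed.
Lemma fps_der_iter k f n : iter k fps_der f n = n%:R ^+ k * f n.
Proof. by elim: k => [|k IH] /=; rewrite ?mul1r // IH exprS mulrA. Qed.

Definition fps_supp m r f := forall n, (n %% m != r %% m)%N -> f n = 0.

Lemma fps_suppM m r s f g : fps_supp m r f -> fps_supp m s g -> fps_supp m (r + s) (f * g).
Proof.
move=> fr gs n nrs; rewrite fpsM big1 // => i _.
have le_in : (i <= n)%N by rewrite -ltnS.
case: (boolP (i %% m == r %% m)%N) => [/eqP im|/fr->]; last by rewrite mul0r.
case: (boolP ((n - i) %% m == s %% m)%N) => [/eqP nim|/gs->]; last by rewrite mulr0.
case/eqP: nrs; have -> : n = (i + (n - i))%N by rewrite subnKC.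
by rewrite -modnDm im nim modnDm.
Qed.
Lemma fps_suppX m r f k : fps_supp m r f -> fps_supp m (r * k) (f ^+ k).
Proof.
move=> fr; elim: k => [|k IH]; last by rewrite exprS mulnS; apply: fps_suppM.
by move=> n; rewrite muln0 expr0 fps1; case: n => // /eqP[].
Qed.
Lemma fps_supp_dil m k f : (0 < m)%N -> (m %| k)%N -> fps_supp m 0 (fps_dil k f).
Proof.
move=> m0 mk n; rewrite mod0n /= => nm; case: ifP => // /(dvdn_trans mk).
by rewrite /dvdn (negPf nm).
Qed.
(** At a positive index the coefficient vanishes if the index is odd and equals the one at half the
    index otherwise, so descent applies. *)
Lemma fps_dil2_fix f : fps_dil 2 f = f -> forall n, f n.+1 = 0.
Proof.
move=> ff; elim/ltn_ind=> n IH; rewrite -ff /=; case: ifP => // /dvdnP[[|m] E] //.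
by rewrite E mulnK // IH //; lia.
Qed.

End FpsRing.

Section FpsDomain.
Local Open Scope ring_scope.
Variable F : fieldType.
Implicit Types f g : fps F.

(** In degree n + 3 the left side only involves f up to index (n + 3) / 2 < n + 2, whereas the right
    side is [t 1 * f n.+2] plus terms with smaller indices of f. So all coefficients vanish by
    induction. *)
Lemma fps_dil2_uniq (s t f : fps F) : s * fps_dil 2 f = t * f ->
  t 0%N = 0 -> t 1%N != 0 -> f 0%N = 0 -> f 1%N = 0 -> f = 0.
Proof.
move=> E t0 t1 f0 f1; apply: fpsP; elim/ltn_ind => -[|[|n]] IH //.
have := congr1 (fun u : fps F => u n.+3) E; rewrite !fpsM.
rewrite big1 => [|i _]; last first.
  rewrite /=; case: ifP; last by rewrite mulr0.
  move=> /dvdnP[m Em]; rewrite Em mulnK // IH ?mulr0 //.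
  by have := leq_subr i n.+3; lia.
rewrite big_ord_recl /= t0 mul0r add0r big_ord_recl /= big1 => [|i _]; last first.
  by rewrite IH ?mulr0 // /bump /=; have := ltn_ord i; lia.
rewrite addr0 /bump /= subn1 /= => /eqP; rewrite eq_sym mulf_eq0 (negPf t1) /=.
by move/eqP.
Qed.

End FpsDomain.

(** * The Frobenius map on power series over F_p *)

Section Frobenius.
Local Open Scope ring_scope.
Variable p : nat.
Hypothesis p_pr : prime p.

Lemma Fp_expp (c : 'F_p) : c ^+ p = c.
Proof. by have := expf_card c; rewrite card_Fp. Qed.

(** On truncations, the p-th power is additive and fixes the coefficients by Fermat's little
    theorem. *)
Lemma fps_Frobenius (f : fps 'F_p) : f ^+ p = fps_dil p f.
Proof.
apply: fpsP => n; have p0 := prime_gt0 p_pr.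
rewrite (fps_agreeX p (@fps_agree_trunc _ n f)) // (@fps_dil_poly _ p f n) //.
congr ((polyseq _)`_n); have pch : p \in [pchar {poly 'F_p}] by rewrite pchar_poly; exact: pchar_Fp.
rewrite /fps_trunc poly_def -(pFrobenius_autE pch) rmorph_sum /=.
rewrite [RHS]raddf_sum /=.
apply: eq_bigr => i _; rewrite pFrobenius_autE exprZn Fp_expp -exprM mulnC exprM.
by rewrite comp_polyZ comp_Xn_poly.
Qed.

Lemma fps_pchar0 : p%:R = 0 :> fps 'F_p.
Proof. by apply: fpsP => n; rewrite fps_nat (pcharf0 (pchar_Fp p_pr)) mul0r. Qed.

End Frobenius.

(** * Theta functions and the arithmetic-geometric mean *)

Section SquareRoots.

Definition zrange (N : nat) : seq int :=
  map Posz (iota 0 N.+1) ++ map (fun i => - Posz i)%R (iota 1 N).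

Lemma mem_zrange N c : (c \in zrange N) = (`|c| <= N)%N.
Proof.
rewrite mem_cat; apply/orP/idP => [[]/mapP[i]|]; rewrite ?mem_iota.
- by move=> iN ->; rewrite absz_nat; lia.
- by move=> iN ->; rewrite abszN absz_nat; lia.
case: c => [i|i] iN; [left | right]; apply/mapP.
  by exists i => //; rewrite mem_iota; move: iN; rewrite absz_nat; lia.
by exists i.+1 => //; rewrite mem_iota; move: iN; lia.
Qed.

Lemma zrange_uniq N : uniq (zrange N).
Proof.
rewrite cat_uniq !map_inj_uniq ?iota_uniq ?andTb ?andbT; first last.
- by move=> i j [].
- by move=> i j /oppr_inj[].
apply/hasPn => c /mapP[i]; rewrite mem_iota => iN ->.
by apply/mapP => -[j _]; move: iN; lia.
Qed.

Opaque zrange.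

Definition sqroots (n : nat) : seq int :=
  [seq c <- zrange n | (c * c == n%:Z)%R].
Definition sqpairs (n : nat) : seq (int * int) :=
  [seq z <- allpairs pair (zrange n) (zrange n) | (z.1 * z.1 + z.2 * z.2 == n%:Z)%R].

(** This bound makes the search range [zrange n] exhaustive in [sqroots] and [sqpairs]. *)
Lemma absz_le_sqr (c : int) n : (c * c <= n%:Z)%R -> `|c| <= n.
Proof.
have -> : (c * c)%R = Posz (`|c| * `|c|) by case: c => k; lia.
by case: `|c| => // k; nia.
Qed.

Lemma int_parity (c : int) : exists d : int, c = (2 * d)%R \/ c = (2 * d + 1)%R.
Proof.
exists (divz c 2); have := divz_eq c 2.
have : (0 <= modz c 2 < 2)%R by rewrite modz_ge0 // ltz_pmod.
by move=> ? ?; lia.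
Qed.

Lemma mem_sqroots n c : (c \in sqroots n) = (c * c == n%:Z)%R.
Proof.
rewrite mem_filter mem_zrange; case: eqP => [E|//]; rewrite andTb.
by apply: absz_le_sqr; rewrite E.
Qed.
Lemma sqroots_uniq n : uniq (sqroots n).
Proof. exact/filter_uniq/zrange_uniq. Qed.
Lemma mem_sqpairs n z : (z \in sqpairs n) = (z.1 * z.1 + z.2 * z.2 == n%:Z)%R.
Proof.
rewrite mem_filter; case: eqP => [E|//]; rewrite andTb.
apply/allpairsP; exists z; rewrite !mem_zrange -surjective_pairing.
by split=> //; apply: absz_le_sqr; rewrite -E ?lerDl ?lerDr -expr2 sqr_ge0.
Qed.
Lemma sqpairs_uniq n : uniq (sqpairs n).
Proof.
apply/filter_uniq/allpairs_uniq; try exact: zrange_uniq.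
by move=> [c d] [c' d'].
Qed.

Lemma perm_sqroots4 m : perm_eq (sqroots (4 * m)) (map (fun c => 2 * c)%R (sqroots m)).
Proof.
apply: uniq_perm; rewrite ?map_inj_uniq ?sqroots_uniq //; first by move=> c d; lia.
move=> c; rewrite mem_sqroots; apply/idP/mapP => [/eqP E|[d]].
  case: (int_parity c) => d [] Ec; last by move: E; rewrite Ec; lia.
  by exists d => //; rewrite mem_sqroots; apply/eqP; move: E; rewrite Ec; lia.
by rewrite mem_sqroots => /eqP E ->; apply/eqP; lia.
Qed.

(** If c^2 + d^2 is even then c and d have the same parity, so (c, d) = (e + f, e - f) for integers
    e, f with e^2 + f^2 half as large. *)
Lemma perm_sqpairs2 m :
  perm_eq (sqpairs (2 * m)) (map (fun z => (z.1 + z.2, z.1 - z.2)%R) (sqpairs m)).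
Proof.
apply: uniq_perm; rewrite ?map_inj_uniq ?sqpairs_uniq //.
  by move=> [c d] [c' d'] /= [? ?]; congr pair; lia.
move=> [c d]; rewrite mem_sqpairs; apply/idP/mapP => /= [/eqP E|[[c' d']]].
  case: (int_parity (c + d)) => e [] Ecd.
    have Ec : c = (2 * e - d)%R by lia.
    exists (e, e - d)%R; last by congr pair; rewrite /= ?Ec; lia.
    by rewrite mem_sqpairs /=; apply/eqP; move: E; rewrite Ec; lia.
  have Ec : c = (2 * e + 1 - d)%R by lia.
  by move: E; rewrite Ec; lia.
by rewrite mem_sqpairs /= => /eqP E [-> ->]; apply/eqP; lia.
Qed.

Lemma perm_sqpairs_swap m : perm_eq (sqpairs m) (map (fun z => (z.2, z.1)) (sqpairs m)).
Proof.
apply: uniq_perm; rewrite ?map_inj_uniq ?sqpairs_uniq //.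
  by move=> [c d] [c' d'] /= [-> ->].
move=> [c d]; rewrite mem_sqpairs; apply/idP/mapP => /= [E|[[c' d']]].
  by exists (d, c); rewrite // mem_sqpairs /= addrC.
by rewrite mem_sqpairs /= => /eqP E [-> ->]; rewrite addrC; apply/eqP.
Qed.
End SquareRoots.

Section Theta.
Local Open Scope ring_scope.
Variable R : comNzRingType.

Definition wtheta (e : int -> R) : fps R := Fps (fun n => \sum_(c <- sqroots n) e c).

Lemma sqroots_range N n : (n <= N)%N ->
  perm_eq (sqroots n) [seq c <- zrange N | c * c == n%:Z].
Proof.
move=> nN; apply: uniq_perm; rewrite ?filter_uniq ?zrange_uniq ?sqroots_uniq //.
move=> c; rewrite mem_sqroots mem_filter mem_zrange.
case: eqP => [E|//]; rewrite andTb; apply/esym/absz_le_sqr; rewrite E; lia.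
Qed.

Lemma wthetaM e1 e2 n :
  (wtheta e1 * wtheta e2) n = \sum_(z <- sqpairs n) e1 z.1 * e2 z.2.
Proof.
rewrite fpsM [RHS]big_filter [RHS]big_mkcond [RHS]big_allpairs_dep /=.
under eq_bigr => i _.
  rewrite /wtheta /=.
  rewrite (perm_big _ (@sqroots_range n i _)); last by rewrite -ltnS.
  rewrite (perm_big _ (@sqroots_range n (n - i) _)); last exact: leq_subr.
  rewrite !big_filter big_distrlr /= big_mkcond /=; over.
rewrite exchange_big /=; apply: eq_bigr => c _.
(* A given c only meets the index i = c^2 of the convolution; if c^2 > n, both sides are zero. *)
case: (boolP (c * c <= n%:Z)) => [le_cn|gt_cn]; last first.
  rewrite big1 => [|i _]; last by case: eqP => // E; have := ltn_ord i; lia.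
  rewrite big1 // => d _; case: eqP => // E.
  by have := sqr_ge0 d; rewrite expr2; lia.
have ltn : (`|c| * `|c| < n.+1)%N by lia.
pose G i := \sum_(d <- zrange n | d * d == (n - i)%N) e1 c * e2 d.
transitivity (G (`|c| * `|c|)%N).
  rewrite (bigD1 (Ordinal ltn)) //=; have -> : c * c == (`|c| * `|c|)%N by apply/eqP; lia.
  rewrite -[RHS]addr0; congr (_ + _); apply: big1 => i ne.
  by case: eqP => // E; case/eqP: ne; apply: val_inj => /=; lia.
rewrite /G big_mkcond; apply: eq_bigr => d _.
by congr (if _ then _ else _); apply/eqP/eqP; lia.
Qed.

Definition theta : fps R := wtheta (fun=> 1).
(** As c and c^2 have the same parity, this is [theta] at -q. *)
Definition theta_alt : fps R := wtheta (fun c => (-1) ^+ `|c|).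

(** The pair (c, d) contributes 1 + (-1)^(c + d), where c + d has the parity of the exponent. Odd
    exponents cancel, and [perm_sqpairs2] halves the even ones. *)
Lemma theta_agm1 : theta ^+ 2 + theta_alt ^+ 2 = 2%:R * fps_dil 2 (theta ^+ 2).
Proof.
apply: fpsP => n; rewrite fpsD fps_natM fps_dilE !expr2 !wthetaM -big_split /=.
case: ifP => [/dvdnP[m ->]|odd_n].
  rewrite mulnK // -(mulnC 2) (perm_big _ (perm_sqpairs2 m)) big_map /=.
  rewrite mulr_sumr; apply: eq_bigr => -[c d] _ /=.
  rewrite -exprD -signr_odd; have -> : odd (`|c + d| + `|c - d|) = false by lia.
  by rewrite expr0; ring.
rewrite mulr0 big_seq big1 // => -[c d]; rewrite mem_sqpairs /= => /eqP E.
rewrite -exprD -signr_odd; have -> : odd (`|c| + `|d|) by nia.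
by rewrite expr1; ring.
Qed.

Hypothesis two_reg : GRing.lreg (2%:R : R).

(** At even exponents, [perm_sqpairs2] turns the sign of d into (-1)^(c - d), the sign in the square
    of [theta_alt]. At odd exponents c and d have opposite parity, so swapping them shows that twice
    the coefficient is zero. *)
Lemma theta_agm2 : theta * theta_alt = fps_dil 2 (theta_alt ^+ 2).
Proof.
apply: fpsP => n; rewrite fps_dilE !expr2 !wthetaM.
case: ifP => [/dvdnP[m ->]|odd_n].
  rewrite mulnK // -(mulnC 2) (perm_big _ (perm_sqpairs2 m)) big_map /=.
  apply: eq_bigr => -[c d] _ /=; rewrite mul1r -exprD -signr_odd -[RHS]signr_odd.
  by congr (_ ^+ nat_of_bool _); lia.
apply: two_reg; rewrite mulr0 mulr_natl mulr2n.
rewrite {1}(perm_big _ (perm_sqpairs_swap n)) big_map -big_split /=.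
rewrite big_seq big1 // => -[c d]; rewrite mem_sqpairs /= !mul1r => /eqP E.
rewrite -signr_odd -[X in _ + X]signr_odd; have -> : odd `|d| = ~~ odd `|c| by nia.
by rewrite signrN addrN.
Qed.

(** Odd c cancel, and even c = 2 d count twice, with exponent 4 d^2. *)
Lemma theta_even_part : theta + theta_alt = 2%:R * fps_dil 4 theta.
Proof.
apply: fpsP => n; rewrite fpsD fps_natM fps_dilE -big_split /=.
case: ifP => [/dvdnP[m ->]|n4].
  rewrite mulnK // -(mulnC 4) (perm_big _ (perm_sqroots4 m)) big_map /=.
  rewrite mulr_sumr; apply: eq_bigr => c _ /=.
  by rewrite -signr_odd abszM oddM /= mulr1.
rewrite mulr0 big_seq big1 // => c; rewrite mem_sqroots => /eqP E.
case: (int_parity c) => d [] Ec; first by move: E; rewrite Ec; lia.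
by rewrite -signr_odd; have -> : odd `|c|; [lia | rewrite addrN].
Qed.

(** Only odd c survive, and odd squares are 1 mod 8. *)
Lemma theta_odd_part : fps_supp 8 1 (theta - theta_alt).
Proof.
move=> n n8; rewrite fpsD fpsN -sumrB big_seq big1 // => c.
rewrite mem_sqroots => /eqP E; rewrite -signr_odd.
case: (int_parity c) => d [] Ec; first by have -> : odd `|c| = false; [lia | rewrite subrr].
case/eqP: n8; case: (int_parity d) => e [] Ed; move: E; rewrite Ec Ed; lia.
Qed.

Lemma theta0 : theta 0%N = 1.
Proof. by rewrite /= big_filter big_mkcond big_cons /= big_nil addr0. Qed.
Lemma theta_alt0 : theta_alt 0%N = 1.
Proof. by rewrite /= big_filter big_mkcond big_cons /= big_nil addr0. Qed.
Lemma theta1 : theta 1%N = 2%:R.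
Proof. by rewrite /= big_filter big_mkcond !big_cons /= big_nil addr0 add0r. Qed.
Lemma theta_alt1 : theta_alt 1%N = - 2%:R.
Proof. by rewrite /= big_filter big_mkcond !big_cons /= big_nil addr0 add0r expr1 -opprD. Qed.
End Theta.

(** * Binary forms modulo p *)

Section HomogeneousForms.
Variable p : nat.

(* The list [c_0; ...; c_n] stands for the binary form
   \sum_i c_i x^i y^(n-i) of degree n over Z/p; unlike {poly 'F_p}, this
   encoding computes. *)
Fixpoint form_add (s t : seq nat) : seq nat :=
  match s, t with
  | c :: s', d :: t' => (c + d) %% p :: form_add s' t'
  | _, _ => [::]
  end.
Definition form_scale (c : nat) (s : seq nat) : seq nat := [seq c * d %% p | d <- s].
(** The length of a list encodes the degree: appending zeros multiplies by a power of y, and a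
    leading 0 multiplies by x. The base case is a zero list of the length that keeps the two
    summands aligned. *)
Fixpoint form_mul (s t : seq nat) : seq nat :=
  match s with
  | [::] => nseq (size t).-1 0
  | c :: s' => form_add (form_scale c t ++ nseq (size s') 0) (0 :: form_mul s' t)
  end.
Definition form_exp (s : seq nat) (n : nat) : seq nat := iter n (form_mul s) [:: 1].
(** For [i = 0] this is x d/dx; a general start is needed for the recursion. *)
Fixpoint form_euler (i : nat) (s : seq nat) : seq nat :=
  match s with
  | [::] => [::]
  | c :: s' => i * c %% p :: form_euler i.+1 s'
  end.
(** Horner's scheme for substituting [l1] for x and [l2] for y, two forms of the same degree. *)
Fixpoint form_comp (s l1 l2 : seq nat) : seq nat :=
  match s with
  | [::] => [::]
  | [:: c] => [:: c]
  | c :: s' => form_add (form_scale c (form_exp l2 (size s'))) (form_mul l1 (form_comp s' l1 l2))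
  end.

Lemma size_form_add s t : size s = size t -> size (form_add s t) = size t.
Proof. by elim: s t => [|c s IH] [|d t] //= [/IH->]. Qed.
Lemma size_form_mul s t : 0 < size t -> size (form_mul s t) = (size s + size t).-1.
Proof.
move=> t0; elim: s => [|c s IH] /=; first by rewrite size_nseq.
by rewrite size_form_add /= IH ?size_cat ?size_map ?size_nseq; lia.
Qed.
Lemma size_form_exp s n : 0 < size s -> size (form_exp s n) = n * (size s).-1 + 1.
Proof.
move=> s0; elim: n => [|n IH] //.
by rewrite -[form_exp _ _]/(form_mul s (form_exp s n)) size_form_mul IH; nia.
Qed.
Lemma size_form_euler i s : size (form_euler i s) = size s.
Proof. by elim: s i => //= c s IH i; rewrite IH. Qed.
Lemma size_form_comp s l1 l2 : 0 < size l1 -> size l1 = size l2 ->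
  size (form_comp s l1 l2) = if s is c :: s' then size s' * (size l1).-1 + 1 else 0.
Proof.
move=> l0 l12; elim: s => [|c [|d s] IH] //=.
set g := match s with [::] => _ | _ => _ end.
have gE : g = form_comp (d :: s) l1 l2 by [].
have gs : size (form_mul l1 g) = (size s).+1 * (size l1).-1 + 1.
  by rewrite size_form_mul gE IH /=; nia.
by rewrite size_form_add gs // size_map -[form_mul _ _]/(form_exp l2 (size s).+1)
  size_form_exp -?l12.
Qed.

Local Open Scope ring_scope.
Variable R : comNzRingType.
Hypothesis p0 : p%:R = 0 :> R.
Implicit Types x y : R.

Fixpoint form_eval (s : seq nat) x y : R :=
  match s with
  | [::] => 0
  | c :: s' => c%:R * y ^+ size s' + x * form_eval s' x y
  end.

Lemma natr_modp (n : nat) : (n %% p)%:R = n%:R :> R.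
Proof. by rewrite [in RHS](divn_eq n p) natrD natrM p0 mulr0 add0r. Qed.

Lemma form_eval_add s t x y : size s = size t ->
  form_eval (form_add s t) x y = form_eval s x y + form_eval t x y.
Proof.
elim: s t => [|c s IH] [|d t] //=; first by rewrite addr0.
by case=> st; rewrite natr_modp size_form_add // IH // natrD st; ring.
Qed.
Lemma form_eval_scale c s x y : form_eval (form_scale c s) x y = c%:R * form_eval s x y.
Proof.
elim: s => [|d s IH] /=; first by rewrite mulr0.
by rewrite IH natr_modp size_map natrM; ring.
Qed.
Lemma form_eval_nseq0 n x y : form_eval (nseq n 0%N) x y = 0.
Proof. by elim: n => [|n IH] //=; rewrite IH mul0r mulr0 addr0. Qed.
Lemma form_eval_pad s n x y :
  form_eval (s ++ nseq n 0%N) x y = form_eval s x y * y ^+ n.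
Proof.
elim: s => [|c s IH] /=; first by rewrite form_eval_nseq0 mul0r.
by rewrite IH size_cat size_nseq exprD; ring.
Qed.
Lemma form_eval_mul s t x y : (0 < size t)%N ->
  form_eval (form_mul s t) x y = form_eval s x y * form_eval t x y.
Proof.
move=> t0; elim: s => [|c s IH] /=; first by rewrite form_eval_nseq0 mul0r.
rewrite form_eval_add /=; last first.
  by rewrite size_form_mul // size_cat size_map size_nseq; lia.
by rewrite form_eval_pad form_eval_scale IH; ring.
Qed.
Lemma form_eval_exp s n x y : (0 < size s)%N ->
  form_eval (form_exp s n) x y = form_eval s x y ^+ n.
Proof.
move=> s0; elim: n => [|n IH]; first by rewrite /= mulr0 addr0 mulr1.
by rewrite -[form_exp _ _]/(form_mul s (form_exp s n)) form_eval_mul ?size_form_exp ?addn1 // IH exprS.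
Qed.
Lemma form_eval_euler1 i s x y :
  form_eval (form_euler i.+1 s) x y = form_eval (form_euler i s) x y + form_eval s x y.
Proof.
elim: s i => [|c s IH] i /=; first by rewrite addr0.
by rewrite IH !size_form_euler !natr_modp !natrM mulrSr; ring.
Qed.
Lemma form_eval_comp s l1 l2 x y : (0 < size l1)%N -> size l1 = size l2 ->
  form_eval (form_comp s l1 l2) x y = form_eval s (form_eval l1 x y) (form_eval l2 x y).
Proof.
move=> l0 l12; elim: s => [|c [|d s] IH] //; first by rewrite /= !mulr0.
have sz := size_form_comp (d :: s) l0 l12.
rewrite -[form_comp _ _ _]/(form_add (form_scale c (form_exp l2 (size s).+1))
  (form_mul l1 (form_comp (d :: s) l1 l2))).
rewrite form_eval_add.
  rewrite form_eval_scale form_eval_exp -?l12 // form_eval_mul ?sz ?addn1 //.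
  by rewrite IH.
by rewrite size_form_mul sz ?size_map ?size_form_exp -?l12 //=; nia.
Qed.
End HomogeneousForms.

(** * Derivatives of binary forms in two series with known logarithmic derivatives *)

Section FormDerivative.
Local Open Scope ring_scope.
Variable p : nat.
Variable F : comNzRingType.
Hypothesis p0 : p%:R = 0 :> fps F.
Variables (x y u w : fps F).
Hypothesis Dx : fps_der x = x * (u + w).
Hypothesis Dy : fps_der y = y * u.

Lemma fps_der_expE (b v : fps F) n : fps_der b = b * v ->
  fps_der (b ^+ n) = n%:R * v * b ^+ n.
Proof.
move=> Db; case: n => [|n]; first by rewrite expr0 fps_der1 !mul0r.
by rewrite fps_derX Db exprS; ring.
Qed.

(** The monomial x^i y^(d - i) has logarithmic derivative d u + i w, and the factor i is what
    [form_euler] produces. *)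
Lemma fps_der_form s : fps_der (form_eval s x y) =
  (size s).-1%:R * u * form_eval s x y + w * form_eval (form_euler p 0 s) x y.
Proof.
elim: s => [|c s IH] /=.
  by rewrite !mulr0 addr0; apply: fpsP => n /=; rewrite mulr0.
rewrite fps_derD !fps_derM fps_der_nat (fps_der_expE _ Dy) Dx IH.
rewrite (form_eval_euler1 p0) mul0n mod0n.
case: s {IH} => [|d s]; rewrite [size _]/= ?mulr0n ?mul0r ?mulr0; first by rewrite /=; ring.
by rewrite [(size (d :: s)).-1]/= mulrS; ring.
Qed.

Variables (r : nat) (b v : fps F) (V W : seq nat).
Hypothesis Db : fps_der b = b * v.
Hypothesis uE : u = 4%:R * v.
Hypothesis VE : v = form_eval V x y.
Hypothesis WE : w = form_eval W x y.
Hypothesis szVW : size V = size W.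
Hypothesis V0 : (0 < size V)%N.

(** For t of degree d, D(b^r t) = b^r ((r + 4 d) v t + w x dt/dx). Replacing v and w by their forms
    [V] and [W] makes iterated derivatives computable. *)
Definition form_der (s : seq nat) : seq nat :=
  form_add p (form_scale p (r + 4 * (size s).-1) (form_mul p V s))
             (form_mul p W (form_euler p 0 s)).

Lemma size_form_der s : (0 < size s)%N -> (0 < size (form_der s))%N.
Proof.
move=> s0; rewrite size_form_add ?size_map ?size_form_mul ?size_form_euler ?szVW //.
by rewrite -szVW; lia.
Qed.

Lemma fps_der_exp_form s : (0 < size s)%N ->
  fps_der (b ^+ r * form_eval s x y) = b ^+ r * form_eval (form_der s) x y.
Proof.
move=> s0; rewrite /form_der (form_eval_add p0); last first.
  by rewrite size_map !size_form_mul ?size_form_euler ?szVW.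
rewrite (form_eval_scale p0) !(form_eval_mul p0) ?size_form_euler // -VE -WE.
rewrite fps_derM (fps_der_expE _ Db) fps_der_form uE natrD natrM.
ring.
Qed.

Lemma fps_der_iter_form k s : (0 < size s)%N ->
  iter k (@fps_der F) (b ^+ r * form_eval s x y) =
  b ^+ r * form_eval (iter k form_der s) x y.
Proof.
move=> s0; elim: k => [|k IH] //=; rewrite IH fps_der_exp_form //.
by elim: k {IH} => //= k; exact: size_form_der.
Qed.
End FormDerivative.

(** * Reduction modulo p *)

Section ThetaWronskian.
Local Open Scope ring_scope.
Variable F : fieldType.
Hypothesis two_neq0 : 2%:R != 0 :> F.

Lemma two_lreg : GRing.lreg (2%:R : F).
Proof. exact: mulfI. Qed.

Lemma fpsM1 (f g : fps F) : (f * g) 1%N = f 0%N * g 1%N + f 1%N * g 0%N.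
Proof. by rewrite fpsM !big_ord_recl big_ord0 addr0. Qed.

(* The difference C of the two sides satisfies
   8 a(q^2) b(q^2) C(q^2) = (a^2 - b^2) C(q), which forces C = 0. *)
Lemma theta_wronskian :
  4%:R * (theta_alt F * fps_der (theta F) - theta F * fps_der (theta_alt F)) =
  theta F * theta_alt F * (theta F ^+ 4 - theta_alt F ^+ 4).
Proof.
pose a := theta F; pose b := theta_alt F.
have E1 := theta_agm1 F; have E2 := theta_agm2 two_lreg.
rewrite -/a -/b in E1 E2 *; rewrite !fps_dilX // in E1 E2.
set a2 := fps_dil 2 a in E1; set b2 := fps_dil 2 b in E2.
pose A2 := fps_dil 2 (fps_der a); pose B2 := fps_dil 2 (fps_der b).
have Da2 : fps_der a2 = 2%:R * A2 by rewrite fps_der_dil.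
have Db2 : fps_der b2 = 2%:R * B2 by rewrite fps_der_dil.
have E3 := congr1 (@fps_der F) E1; have E4 := congr1 (@fps_der F) E2.
rewrite fps_derD fps_derM fps_der_nat !fps_derX Da2 in E3.
rewrite fps_derM fps_derX Db2 in E4.
set C := 4%:R * (b * fps_der a - a * fps_der b) - a * b * (a ^+ 4 - b ^+ 4).
suff : C = 0 by move/eqP; rewrite subr_eq0 => /eqP.
have C2 : fps_dil 2 C = 4%:R * (b2 * A2 - a2 * B2) - a2 * b2 * (a2 ^+ 4 - b2 ^+ 4).
  by rewrite !(fps_dilD, fps_dilN, fps_dilM, fps_dilX, fps_dil_nat).
apply: (@fps_dil2_uniq _ (8%:R * a2 * b2) (a ^+ 2 - b ^+ 2)).
(* The right member is assembled from the right sides of [E1] to [E4], with their residual [0 *] and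
   [^+ 1], so that rewriting backwards turns all series in q^2 into series in q. *)
- have -> : 8%:R * a2 * b2 * fps_dil 2 C =
    4%:R * ((0 * a2 ^+ 2 + 2%:R * (2%:R * a2 ^+ 1 * (2%:R * A2))) * b2 ^+ 2
           - (2%:R * a2 ^+ 2) * (2%:R * b2 ^+ 1 * (2%:R * B2)))
    - (2%:R * a2 ^+ 2) * b2 ^+ 2 * ((2%:R * a2 ^+ 2) ^+ 2 - 4%:R * (b2 ^+ 2) ^+ 2).
    by rewrite C2; ring.
  by rewrite -E3 -E4 -E1 -E2 /C; ring.
- by rewrite fpsD fpsN !fpsX0 theta0 theta_alt0; ring.
- rewrite fpsD fpsN !expr2 !fpsM1 theta0 theta_alt0 theta1 theta_alt1.
  have -> : 1 * 2%:R + 2%:R * 1 - (1 * - 2%:R + - 2%:R * 1) = 2%:R ^+ 3 :> F by ring.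
  by rewrite expf_neq0.
- rewrite /C !(fpsD, fpsN, fpsM0, fpsX0) theta0 theta_alt0 /= !mul0r; ring.
rewrite /C !(exprS _ 3, exprS _ 2, exprS _ 1, expr1).
rewrite fpsD fpsN fps_natM !(fpsD, fpsN, fpsM1, fpsM0) !fps_derE.
by rewrite theta0 theta_alt0 theta1 theta_alt1; ring.
Qed.
End ThetaWronskian.

Section Forms.
Local Open Scope ring_scope.

Lemma fps_dil_form (R : comNzRingType) k s (x y : fps R) : (0 < k)%N ->
  fps_dil k (form_eval s x y) = form_eval s (fps_dil k x) (fps_dil k y).
Proof.
move=> k0; elim: s => [|c s IH] /=; first by apply: fpsP => n /=; case: ifP.
by rewrite fps_dilD !fps_dilM // fps_dilX // fps_dil_nat // IH.
Qed.

Lemma form_eval_const (R : comNzRingType) s (x y : fps R) :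
  x 0%N = 1 -> y 0%N = 1 -> form_eval s x y 0%N = (sumn s)%:R.
Proof.
move=> x0 y0; elim: s => [|c s IH] //; rewrite [form_eval _ _ _]/=.
by rewrite fpsD fps_natM fpsM0 IH x0 fpsX0 y0 expr1n natrD; ring.
Qed.
End Forms.

Section OddPrime.
Local Open Scope ring_scope.
Variable p : nat.
Hypothesis p_pr : prime p.
Hypothesis p_odd : odd p.

Lemma Fp_two_neq0 : 2%:R != 0 :> 'F_p.
Proof.
rewrite -(dvdn_pcharf (pchar_Fp p_pr)); apply/negP => /dvdn_leq; move: p_odd (prime_gt1 p_pr).
by case: (p) => [|[|[|k]]] //=; lia.
Qed.

Lemma fps_two_lreg : GRing.lreg (2%:R : fps 'F_p).
Proof.
move=> f g E; apply: fpsP => n; apply: (mulfI Fp_two_neq0).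
by have := congr1 (fun u : fps 'F_p => u n) E; rewrite !fps_natM.
Qed.
End OddPrime.

(** * The overpartition series modulo p along multiples of p *)

Section OverpartitionProgression.
Local Open Scope ring_scope.
Variable p : nat.
Hypothesis p_pr : prime p.
Hypothesis p_odd : odd p.
Let a := theta 'F_p.
Let b := theta_alt 'F_p.
Let X := a ^+ 4.
Let Y := b ^+ 4.
Variable P : fps 'F_p.
Hypothesis Pb : b * P = 1.

Let p0 : p%:R = 0 :> fps 'F_p. Proof. exact: fps_pchar0. Qed.

Let two_neq0 := Fp_two_neq0 p_pr p_odd.

Let natE (m n : nat) : (m = n %[mod p])%N -> m%:R = n%:R :> fps 'F_p.
Proof. by move=> mn; rewrite -(natr_modp p0 m) mn (natr_modp p0). Qed.

Variable h : seq nat.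
Hypothesis h0 : (0 < size h)%N.
Let qtr := (((p + 1) %/ 2) ^ 2)%N.
(* The supersingular polynomial h is invariant under the isogeny of degree 2,
   whose effect on (a^2, b^2) is the arithmetic-geometric mean step; qtr is 1/4 mod p. *)
Hypothesis h_agm : form_comp p h [:: qtr; 2 * qtr; qtr]%N [:: 0; 1; 0]%N =
                   form_comp p h [:: 0; 0; 1]%N [:: 1; 0; 0]%N.
Hypothesis h1 : (sumn h = 1 %[mod p])%N.

Let half_pE : 2%:R * ((p + 1) %/ 2)%:R = 1 :> fps 'F_p.
Proof.
rewrite -natrM -[RHS]/(1%:R); apply: natE.
have -> : (2 * ((p + 1) %/ 2) = p + 1)%N by have := odd_double_half p; rewrite p_odd; lia.
by rewrite modnDl.
Qed.

(** Under q |-> q^2, X becomes ((a^2 + b^2) / 2)^2 and Y becomes a^2 b^2, so [h_agm] gives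
    invariance. The constant term is the coefficient sum of [h], which is 1 mod p. *)
Lemma hasse_invariant : form_eval h X Y = 1.
Proof.
have agm1 := theta_agm1 'F_p; have agm2 := theta_agm2 (mulfI two_neq0).
rewrite -/a -/b in agm1 agm2.
have E : fps_dil 2 (form_eval h X Y) = form_eval h X Y.
  have -> : X = form_eval [:: 0; 0; 1]%N (a ^+ 2) (b ^+ 2) by rewrite /X /=; ring.
  have -> : Y = form_eval [:: 1; 0; 0]%N (a ^+ 2) (b ^+ 2) by rewrite /Y /=; ring.
  rewrite -[RHS](form_eval_comp p0) // -h_agm (form_eval_comp p0) // fps_dil_form //.
  congr (form_eval h _ _).
    have -> : form_eval [:: qtr; 2 * qtr; qtr]%N (a ^+ 2) (b ^+ 2) =
              qtr%:R * (a ^+ 2 + b ^+ 2) ^+ 2.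
      by rewrite /= [(2 * qtr)%:R]natrM; ring.
    rewrite agm1 /qtr natrX exprMn mulrA -exprMn [_ * 2%:R]mulrC half_pE expr1n mul1r.
    by rewrite -fps_dilX //; congr (fps_dil _ _); rewrite /=; ring.
  have -> : form_eval [:: 0; 1; 0]%N (a ^+ 2) (b ^+ 2) = (a * b) ^+ 2 by rewrite /=; ring.
  by rewrite agm2 -fps_dilX //; congr (fps_dil _ _); rewrite /=; ring.
apply: fpsP => -[|n]; last by rewrite (fps_dil2_fix E).
rewrite form_eval_const ?fpsX0 ?theta0 ?theta_alt0 ?expr1n //.
rewrite -(Fp_nat_mod p_pr) h1 Fp_nat_mod //.
Qed.

Let v := fps_der b * P.
(** Differentiating h(X, Y) = 1 gives 4 deg(h) v + (X - Y) X dh/dX = 0, and 4 deg(h) = -2 mod p by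
    [size_h]; hence v is half of (X - Y) X dh/dX. The list [[:: p.-1; 1]] is x - y. *)
Let V := form_scale p ((p + 1) %/ 2) (form_mul p (form_euler p 0 h) [:: p.-1; 1]%N).
(** The form x - y, multiplied by h = 1 to reach the degree of [V]. *)
Let W := form_mul p h [:: p.-1; 1]%N.
Hypothesis size_h : (4 * (size h).-1 + 2 = 0 %[mod p])%N.

Let Db : fps_der b = b * v.
Proof. by rewrite /v mulrCA Pb mulr1. Qed.

(** Dividing [theta_wronskian] by a b gives 4 Da/a = 4 Db/b + X - Y, and the left side is DX/X. *)
Let Dx : fps_der X = X * (4%:R * v + (X - Y)).
Proof.
have Da : 4%:R * fps_der a = a * (4%:R * v + (X - Y)).
  apply: (@fps_cancel _ b); first exact: theta_alt0.
  have := theta_wronskian two_neq0; rewrite -/a -/b Db -/X -/Y => E.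
  have -> : b * (4%:R * fps_der a) =
     4%:R * (b * fps_der a - a * (b * v)) + 4%:R * a * b * v by ring.
  by rewrite E; ring.
have -> : fps_der X = a ^+ 3 * (4%:R * fps_der a) by rewrite fps_derX; ring.
by rewrite Da /X; ring.
Qed.

Let Dy : fps_der Y = Y * (4%:R * v).
Proof. by rewrite /Y fps_derX Db; ring. Qed.

Let XY : form_eval [:: p.-1; 1]%N X Y = X - Y.
Proof.
have -> : form_eval [:: p.-1; 1]%N X Y = X + (p.-1%:R + 1) * Y - Y by rewrite /=; ring.
by rewrite -mulrSr prednK ?prime_gt0 // p0 mul0r addr0.
Qed.

Let VE : v = form_eval V X Y.
Proof.
apply: (fps_two_lreg p_pr p_odd); rewrite (form_eval_scale p0) [RHS]mulrA half_pE mul1r.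
rewrite (form_eval_mul p0) // XY.
have := congr1 (@fps_der _) hasse_invariant.
rewrite (fps_der_form p0 Dx Dy) fps_der1 hasse_invariant => E.
have S : (4 * (size h).-1 + 2)%:R = 0 :> fps 'F_p by rewrite (natE size_h).
rewrite [RHS]mulrC; set e := form_eval (form_euler _ _ _) _ _ in E *.
(* The inserted multiple of [4 * (size h).-1 + 2] is zero mod p; the other inserted terms reproduce
   the left side of [E]. *)
have -> : (X - Y) * e = (X - Y) * e +
   (size h).-1%:R * (4%:R * v) * 1 - (4 * (size h).-1 + 2)%:R * v + 2%:R * v.
  by rewrite natrD natrM; ring.
by rewrite [(X - Y) * e + _]addrC E S; ring.
Qed.

Let WE : X - Y = form_eval W X Y.
Proof. by rewrite (form_eval_mul p0) // XY hasse_invariant mul1r. Qed.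

Variables (r e k1 k2 r' : nat) (s0 g : seq nat).
Hypothesis s0_gt0 : (0 < size s0)%N.
Hypothesis g_gt0 : (0 < size g)%N.
Hypothesis s0E : b ^+ p.-1 = b ^+ r * form_eval s0 X Y.
Hypothesis re : (r'.+1 * p = r + 4 * e)%N.
(** This encodes f - D^(p-1) f = G^p with b^r divided out: [1%N :: nseq e 0%N] is Y^e, and [re]
    absorbs it into the power of b. The powers of h, equal to 1, bring both sides to the same
    degree. *)
Hypothesis check :
  form_mul p s0 (form_exp p h k1) =
  form_add p (iter p.-1 (form_der p r V W) s0)
    (form_mul p (form_mul p (form_exp p g p) (1%N :: nseq e 0%N)) (form_exp p h k2)).
(** [form_add] truncates to the shorter list, so equal lengths must be secured before evaluating. *)
Hypothesis check_size : size (iter p.-1 (form_der p r V W) s0) =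
  size (form_mul p (form_mul p (form_exp p g p) (1%N :: nseq e 0%N)) (form_exp p h k2)).

(* In characteristic p, f - D^(p-1) f keeps exactly the coefficients of f whose
   index is divisible by p.  For f = b^(p-1) it equals G(q)^p = G(q^p), where
   G = b^(r'+1) g(X, Y), and P = f P^p = f P(q^p) then selects G P. *)
Lemma overpartition_progression n : P (p * n)%N = (b ^+ r' * form_eval g X Y) n.
Proof.
have pgt0 := prime_gt0 p_pr.
pose f := b ^+ p.-1; pose G := b ^+ r'.+1 * form_eval g X Y.
have szVW : size V = size W by rewrite size_map !size_form_mul ?size_form_euler.
have V0 : (0 < size V)%N by rewrite size_map size_form_mul // size_form_euler addnC.
have Df : iter p.-1 (@fps_der _) f = b ^+ r * form_eval (iter p.-1 (form_der p r V W) s0) X Y.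
  by rewrite /f s0E; apply: (fps_der_iter_form p0 Dx Dy r Db (erefl _) VE WE).
have fG : f - iter p.-1 (@fps_der _) f = G ^+ p.
  have := congr1 (fun s => form_eval s X Y) check.
  rewrite (form_eval_mul p0) ?size_form_exp ?addn1 // (form_eval_add p0) //.
  rewrite !(form_eval_mul p0) ?size_form_exp ?addn1 // !(form_eval_exp p0) //.
  rewrite hasse_invariant !expr1n !mulr1 => E.
  rewrite Df /f s0E E mulrDr addrC addKr /G exprMn -exprM re exprD exprM -/Y.
  by rewrite /= (form_eval_nseq0) size_nseq; ring.
pose u := f * fps_dil p P.
(* f P^p = b^(p-1) P^p = P (b P)^(p-1) = P. *)
have uP : u = P.
  rewrite /u -fps_Frobenius //.
  have -> : P ^+ p = P * P ^+ p.-1 by rewrite -exprS prednK.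
  by rewrite mulrCA -exprMn Pb expr1n mulr1.
(* D kills P(q^p) mod p, so this factor behaves as a constant. *)
have Du : iter p.-1 (@fps_der _) u = iter p.-1 (@fps_der _) f * fps_dil p P.
  rewrite /u; elim: p.-1 => //= k ->; rewrite fps_derM fps_der_dil // p0.
  by rewrite mul0r mulr0 addr0.
have : u - iter p.-1 (@fps_der _) u = fps_dil p (G * P).
  by rewrite Du -mulrBl fG fps_Frobenius // -fps_dilM.
move/(congr1 (fun s : fps 'F_p => s (p * n)%N)).
(* At index p n, D^(p-1) multiplies by (p n)^(p-1) = 0, since p - 1 > 0. *)
rewrite fps_dil_mul // uP fpsD fpsN fps_der_iter natrM (pcharf0 (pchar_Fp p_pr)).
have p1 : (0 < p.-1)%N by have := prime_gt1 p_pr; lia.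
rewrite mul0r expr0n (gtn_eqF p1) mul0r subr0 => ->; congr (fps_coef _ n).
by rewrite /G exprS -[RHS]mulr1 -Pb; ring.
Qed.
End OverpartitionProgression.

(** * Overpartitions and Gauss' identity *)

Section OverpartitionCount.

Definition overp_le k n s := is_overpartition n s && all (fun x : nat * bool => x.1 <= k) s.
(* Tails of overpartitions with largest part k: here k may only occur non-overlined. *)
Definition overp_tail k n s :=
  [&& parts_pos s, parts_noninc s, first_occ_ok (Some k) s,
      sumn (map fst s) == n & all (fun x : nat * bool => x.1 <= k) s].

Lemma mem_all_cands n s : parts_pos s -> sumn (map fst s) = n -> s \in undup (all_cands n).
Proof.
move=> pos sum; rewrite mem_undup; apply/flatten_mapP; exists (size s).
  rewrite mem_iota ltnS -sum; elim: s pos {sum} => //= x s IH /andP[x0 /IH].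
  lia.
have : all (fun x : nat * bool => x.1 <= n) s.
  rewrite -sum; elim: s {pos sum} => //= x s IH; rewrite leq_addr /=.
  by apply: sub_all IH => y /leq_trans; apply; rewrite leq_addl.
elim: s pos {sum} => [//|x s IH] /andP[x0 pos] /andP[xn le_n].
apply: (@allpairs_f _ _ _ cons); last exact: IH.
rewrite [x]surjective_pairing; apply: (@allpairs_f _ _ _ pair); last by case: x.2.
by rewrite mem_iota x0 add1n ltnS.
Qed.

Lemma parts_noninc_cons x s :
  parts_noninc (x :: s) = all (fun y => y.1 <= x.1) s && parts_noninc s.
Proof. by rewrite /parts_noninc /= path_sortedE // => y z t; lia. Qed.

(** Parts are nonincreasing, so if k + 1 occurs it comes first, with a free overline flag, and the
    rest may only repeat it non-overlined. *)
Lemma overp_leS k n s : overp_le k.+1 n s = overp_le k n s ||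
  (if s is x :: s' then [&& x.1 == k.+1, k < n & overp_tail k.+1 (n - k.+1) s'] else false).
Proof.
case: s => [|[i f] s]; first by rewrite orbF.
rewrite /overp_le /overp_tail /is_overpartition !parts_noninc_cons /=.
rewrite [if f then true else true]if_same andTb.
case: (ltngtP i k.+1) => [lt|gt|->] /=.
- rewrite orbF (_ : i <= k); last lia.
  case: (boolP (all (fun y => y.1 <= i) s)) => [le_i|]; last by rewrite !(andbF, andFb).
  have -> : all (fun x => x.1 <= k.+1) s by apply: sub_all le_i => y; lia.
  by have -> : all (fun x => x.1 <= k) s by apply: sub_all le_i => y; lia.
- by rewrite (_ : i <= k = false) ?andbF //; lia.
rewrite ltnn !andbF /=.
case: (parts_pos s) => //=; case: (all (fun y => y.1 <= k.+1) s) => //=; rewrite ?andbF //=.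
case: (parts_noninc s); case: (first_occ_ok _ s); rewrite ?andbF //= ?andbT.
by apply/eqP/andP => [|[? /eqP]]; [split; try apply/eqP |]; lia.
Qed.

(** Here a leading k + 1 must be non-overlined; if k + 1 does not occur, the preceding part imposes
    no condition. *)
Lemma overp_tailS k n s : overp_tail k.+1 n s = overp_le k n s ||
  (if s is x :: s' then [&& x == (k.+1, false), k < n & overp_tail k.+1 (n - k.+1) s'] else false).
Proof.
case: s => [|[i f] s]; first by rewrite orbF /overp_tail /overp_le /is_overpartition /= andbT.
rewrite /overp_le /overp_tail /is_overpartition !parts_noninc_cons /= xpair_eqE.
rewrite [if f then true else true]if_same andTb.
case: (ltngtP i k.+1) => [lt|gt|->] /=.
- rewrite orbF if_same andTb (_ : i <= k); last lia.
  case: (boolP (all (fun y => y.1 <= i) s)) => [le_i|]; last by rewrite !(andbF, andFb).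
  have -> : all (fun x => x.1 <= k.+1) s by apply: sub_all le_i => y; lia.
  have -> : all (fun x => x.1 <= k) s by apply: sub_all le_i => y; lia.
  by rewrite !andbT !andbA.
- by rewrite (_ : i <= k = false) ?andbF //; lia.
rewrite ltnn !andbF /=; case: f; rewrite /= ?andbF //=.
case: (parts_pos s) => //=; case: (all (fun y => y.1 <= k.+1) s) => //=; rewrite ?andbF //=.
case: (parts_noninc s); case: (first_occ_ok _ s); rewrite ?andbF //= ?andbT.
by apply/eqP/andP => [|[? /eqP]]; [split; try apply/eqP |]; lia.
Qed.

Definition overp_le_seq k n := [seq s <- undup (all_cands n) | overp_le k n s].
Definition overp_tail_seq k n := [seq s <- undup (all_cands n) | overp_tail k n s].

Lemma mem_overp_le_seq k n s : (s \in overp_le_seq k n) = overp_le k n s.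
Proof.
rewrite mem_filter; case: (boolP (overp_le k n s)) => // /andP[/and4P[pos _ _ /eqP sum] _].
by rewrite mem_all_cands.
Qed.
Lemma mem_overp_tail_seq k n s : (s \in overp_tail_seq k n) = overp_tail k n s.
Proof.
rewrite mem_filter; case: (boolP (overp_tail k n s)) => // /and5P[pos _ _ /eqP sum _].
by rewrite mem_all_cands.
Qed.
Lemma overp_le_seq_uniq k n : uniq (overp_le_seq k n).
Proof. exact/filter_uniq/undup_uniq. Qed.
Lemma overp_tail_seq_uniq k n : uniq (overp_tail_seq k n).
Proof. exact/filter_uniq/undup_uniq. Qed.

Lemma overp_le_part k n s x : overp_le k n (x :: s) -> x.1 <= k.
Proof. by case/andP => _ /= /andP[]. Qed.

Lemma size_overp_le_seqS k n : size (overp_le_seq k.+1 n) =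
  size (overp_le_seq k n) + (if k < n then 2 * size (overp_tail_seq k.+1 (n - k.+1)) else 0).
Proof.
pose t f := if k < n then map (cons (k.+1, f)) (overp_tail_seq k.+1 (n - k.+1)) else [::].
have mem_t f s : (s \in t f) = if s is x :: s' then
    [&& x == (k.+1, f), k < n & overp_tail k.+1 (n - k.+1) s'] else false.
  rewrite /t; case: ifP => kn; last by case: s => // x s; rewrite !andbF.
  apply/mapP/idP => [[s' +] ->|]; first by rewrite mem_overp_tail_seq eqxx.
  case: s => // x s /andP[/eqP-> ts]; exists s => //.
  by rewrite mem_overp_tail_seq.
have t_uniq f : uniq (t f).
  rewrite /t; case: ifP => // _; rewrite map_inj_uniq ?overp_tail_seq_uniq //.
  by move=> s s' [].
have -> : size (overp_le_seq k.+1 n) = size (overp_le_seq k n ++ (t false ++ t true)).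
  apply/perm_size/uniq_perm.
  - exact: overp_le_seq_uniq.
  - rewrite !cat_uniq overp_le_seq_uniq !t_uniq /= andbT.
    apply/andP; split; apply/hasPn => s; rewrite ?mem_cat !mem_t ?mem_overp_le_seq.
      case: s => // x s; rewrite -andb_orl.
      by apply: contraL => /overp_le_part; case: x => i f; rewrite !xpair_eqE /=; lia.
    by case: s => // -[i []] s; rewrite !xpair_eqE ?andbF.
  move=> s; rewrite !mem_cat !mem_t !mem_overp_le_seq overp_leS; congr (_ || _).
  by case: s => // -[i []] s; rewrite !xpair_eqE ?andbF ?andbT ?orbF.
rewrite !size_cat /t; case: ifP => //= _; rewrite !size_map; lia.
Qed.

Lemma size_overp_tail_seqS k n : size (overp_tail_seq k.+1 n) =
  size (overp_le_seq k n) + (if k < n then size (overp_tail_seq k.+1 (n - k.+1)) else 0).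
Proof.
pose t := if k < n then map (cons (k.+1, false)) (overp_tail_seq k.+1 (n - k.+1)) else [::].
have mem_t s : (s \in t) = if s is x :: s' then
    [&& x == (k.+1, false), k < n & overp_tail k.+1 (n - k.+1) s'] else false.
  rewrite /t; case: ifP => kn; last by case: s => // x s; rewrite !andbF.
  apply/mapP/idP => [[s' +] ->|]; first by rewrite mem_overp_tail_seq eqxx.
  case: s => // x s /andP[/eqP-> ts]; exists s => //.
  by rewrite mem_overp_tail_seq.
have t_uniq : uniq t.
  rewrite /t; case: ifP => // _; rewrite map_inj_uniq ?overp_tail_seq_uniq //.
  by move=> s s' [].
have -> : size (overp_tail_seq k.+1 n) = size (overp_le_seq k n ++ t).
  apply/perm_size/uniq_perm.
  - exact: overp_tail_seq_uniq.
  - rewrite !cat_uniq overp_le_seq_uniq t_uniq /= andbT.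
    apply/hasPn => s; rewrite mem_t mem_overp_le_seq.
    case: s => // x s.
    by apply: contraL => /overp_le_part; case: x => i f; rewrite !xpair_eqE /=; lia.
  by move=> s; rewrite mem_cat mem_t mem_overp_le_seq mem_overp_tail_seq overp_tailS.
rewrite size_cat /t; case: ifP => //= _; by rewrite size_map.
Qed.

Lemma size_overp_le_seq k n : n <= k -> size (overp_le_seq k n) = overpartn n.
Proof.
move=> nk; rewrite size_filter; apply: eq_count => s; rewrite /overp_le andbC.
case: (boolP (is_overpartition n s)) => [/and4P[_ _ _ /eqP sum]|]; last by rewrite andbF.
rewrite andbT; apply: (@sub_all _ (fun x => x.1 <= n)) => [x xn|]; first exact: leq_trans nk.
rewrite -sum; elim: s {sum} => //= x s IH; rewrite leq_addr /=.
by apply: sub_all IH => y /leq_trans; apply; rewrite leq_addl.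
Qed.

Lemma size_overp_le_seq0 n : size (overp_le_seq 0 n) = (n == 0).
Proof.
have E s : overp_le 0 n s = (s == [::]) && (n == 0).
  case: s => [|[[|i] f] s]; rewrite /overp_le /is_overpartition //= ?andbF //.
  by rewrite andbT eq_sym.
have [->|n0] := posnP n; last first.
  by apply/eqP; rewrite size_eq0 -[_ == _]negbK -has_filter; apply/hasPn => s _; rewrite E; lia.
by [].
Qed.
End OverpartitionCount.

(** * Generating series of overpartitions and a finite form of Gauss' identity *)

Section OverpartitionSeries.
Local Open Scope ring_scope.
Variable R : comNzRingType.

Definition overp_series : fps R := Fps (fun n => (overpartn n)%:R).

Let M k : fps R := Fps (fun n => (size (overp_le_seq k n))%:R).
Let N k : fps R := Fps (fun n => (size (overp_tail_seq k n))%:R).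

Lemma overp_le_series0 : M 0 = 1.
Proof. by apply: fpsP => n /=; rewrite size_overp_le_seq0. Qed.

(** With x = q^(k+1), the counting recursions read M' = M + 2 x N' and N' = M + x N'; eliminating N'
    gives the factor (1 + x) / (1 - x). *)
Lemma overp_le_seriesS k : (1 - fps_X R k.+1) * M k.+1 = (1 + fps_X R k.+1) * M k.
Proof.
have EM : M k.+1 = M k + 2%:R * (fps_X R k.+1 * N k.+1).
  apply: fpsP => n; rewrite fpsD fps_natM fps_XM /= size_overp_le_seqS natrD.
  by case: ifP; rewrite ?mulr0 // natrM.
have EN : N k.+1 = M k + fps_X R k.+1 * N k.+1.
  apply: fpsP => n; rewrite fpsD fps_XM /= size_overp_tail_seqS natrD.
  by case: ifP.
have {}EN : (1 - fps_X R k.+1) * N k.+1 = M k by rewrite mulrBl mul1r {1}EN addrK.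
by rewrite EM -EN; ring.
Qed.

Definition fps_geom k : fps R := Fps (fun n => (k %| n)%:R).

Lemma fps_geomE k : (0 < k)%N -> (1 - fps_X R k) * fps_geom k = 1.
Proof.
move=> k0; rewrite mulrBl mul1r; apply: fpsP => n; rewrite fpsD fpsN fps_XM /=.
case: leqP => [kn|nk]; first by rewrite dvdn_subl // subrr; case: n kn => //; lia.
rewrite subr0; case: n nk => [|n] nk; first by rewrite dvdn0.
by rewrite gtnNdvd.
Qed.

(* c n j = (q)_n^2 / ((q)_(n-j) (q)_(n+j)); it vanishes for j > n. *)
Fixpoint gauss_coef n j : fps R :=
  if j is i.+1 then gauss_coef n i * (1 - fps_X R (n - i)%N) * fps_geom (n + j)%N else 1.

(** Immediate from the closed form, but proved through the ratio of consecutive j. At j = m + 1 both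
    sides vanish. *)
Lemma gauss_coef_rec m j : (j <= m.+1)%N ->
  gauss_coef m j * (1 - fps_X R m.+1) ^+ 2 =
  gauss_coef m.+1 j * (1 - fps_X R (m.+1 - j)%N) * (1 - fps_X R (m.+1 + j)%N).
Proof.
elim: j => [|j IH] jm; first by rewrite /= subn0 addn0; ring.
have {IH} IH := IH (ltnW jm).
have G1 := @fps_geomE (m + j.+1)%N; have G2 := @fps_geomE (m.+1 + j.+1)%N.
rewrite [gauss_coef m j.+1]/= [gauss_coef m.+1 j.+1]/= subSS.
have -> : gauss_coef m j * (1 - fps_X R (m - j)%N) * fps_geom (m + j.+1)%N *
    (1 - fps_X R m.+1) ^+ 2 = (gauss_coef m j * (1 - fps_X R m.+1) ^+ 2) *
    (1 - fps_X R (m - j)%N) * fps_geom (m + j.+1)%N by ring.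
rewrite IH [(m.+1 + j)%N]addSnnS.
set x1 := fps_X R (m + j.+1)%N in G1 *; set x2 := fps_X R (m.+1 + j.+1)%N in G2 *.
have {}G1 : (1 - x1) * fps_geom (m + j.+1)%N = 1 by apply: G1; rewrite addnS.
have {}G2 : (1 - x2) * fps_geom (m.+1 + j.+1)%N = 1 by apply: G2.
set t := gauss_coef m.+1 j * (1 - fps_X R (m.+1 - j)%N) * (1 - fps_X R (m - j)%N).
transitivity (t * ((1 - x1) * fps_geom (m + j.+1)%N)); first by rewrite /t; ring.
transitivity (t * ((1 - x2) * fps_geom (m.+1 + j.+1)%N)); first by rewrite G1 G2.
by rewrite /t; ring.
Qed.

(** Terms of the finite Gauss identity: the sum over -n <= j <= n equals the product of (1 - q^k) /
    (1 + q^k) for k <= n. [gauss_sum] folds j and -j together. *)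
Definition gauss_term n j : fps R := (-1) ^+ j * fps_X R (j * j)%N * gauss_coef n j.
Definition gauss_sum n : fps R := 1 + 2%:R * \sum_(j < n) gauss_term n j.+1.

Lemma gauss_sum_rec m :
  (1 + fps_X R m.+1) * gauss_sum m.+1 = (1 - fps_X R m.+1) * gauss_sum m.
Proof.
pose n := m.+1; pose x := fps_X R n.
(* Telescoping certificate for the recurrence: K_n = 0 because of its last factor, and K_0 = x (1 -
   x). *)
pose K j := gauss_term n j * fps_X R (n + j)%N * (1 - fps_X R (n - j)%N).
have termE j : (j < n)%N ->
    (1 - x) ^+ 2 * gauss_term m j.+1 - (1 - x ^+ 2) * gauss_term n j.+1 = K j - K j.+1.
  move=> jn.
  have -> : (1 - x) ^+ 2 * gauss_term m j.+1 =
     gauss_term n j.+1 * (1 - fps_X R (n - j.+1)%N) * (1 - fps_X R (n + j.+1)%N).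
    have E := @gauss_coef_rec m j.+1 jn.
    transitivity ((-1) ^+ j.+1 * fps_X R (j.+1 * j.+1)%N *
      (gauss_coef m j.+1 * (1 - fps_X R m.+1) ^+ 2)).
      by rewrite /gauss_term /x /n; ring.
    by rewrite E /gauss_term /n; ring.
  have Kj : K j = - (gauss_term n j.+1 * fps_X R (n - j.+1)%N * (1 - fps_X R (n + j.+1)%N)).
    rewrite /K /gauss_term [gauss_coef n j.+1]/= exprS.
    have -> : fps_X R (j.+1 * j.+1)%N = fps_X R (j * j)%N * fps_X R (j + j.+1)%N.
      by rewrite -fps_XD; congr fps_X; lia.
    have -> : fps_X R (n + j)%N = fps_X R (j + j.+1)%N * fps_X R (n - j.+1)%N.
      by rewrite -fps_XD; congr fps_X; lia.
    have := @fps_geomE (n + j.+1)%N isT; set y := fps_X R (n + j.+1)%N => Ey.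
    set T := (X in X = _); transitivity (T * ((1 - y) * fps_geom (n + j.+1)%N)).
      by rewrite Ey mulr1.
    by rewrite /T; ring.
  have xE : x ^+ 2 = fps_X R (n - j.+1)%N * fps_X R (n + j.+1)%N.
    by rewrite expr2 -!fps_XD; congr fps_X; lia.
  by rewrite Kj /K xE; ring.
have sumE : \sum_(j < n) ((1 - x) ^+ 2 * gauss_term m j.+1 - (1 - x ^+ 2) * gauss_term n j.+1)
    = K 0%N.
  rewrite (eq_bigr (fun j : 'I_n => - (K j.+1 - K j))) => [|j _]; last by rewrite termE // opprB.
  rewrite sumrN -(big_mkord xpredT (fun j => K j.+1 - K j)) telescope_sumr // /K subnn fps_X0.
  by rewrite subrr mulr0 sub0r opprK.
have term0 : gauss_term m n = 0 by rewrite /gauss_term /= subnn fps_X0 subrr !(mulr0, mul0r).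
have mE : gauss_sum m = 1 + 2%:R * \sum_(j < n) gauss_term m j.+1.
  by rewrite /n big_ord_recr /= -/n term0 addr0.
have K0 : K 0%N = x * (1 - x).
  by rewrite /K /gauss_term /= addn0 subn0 fps_X0 -/x; ring.
apply: (@fps_cancel _ (1 - x)); first by rewrite fpsD fpsN /= subr0.
apply/eqP; rewrite -subr_eq0 -oppr_eq0; apply/eqP.
transitivity ((1 - x) ^+ 2 * gauss_sum m - (1 - x ^+ 2) * gauss_sum n).
  by rewrite /x /n; ring.
rewrite mE /gauss_sum.
move: sumE; rewrite big_split /= sumrN -!mulr_sumr K0 => E.
(* The term j = 0 contributes (1 - x)^2 - (1 - x^2) = -2 x (1 - x), which cancels 2 K_0. *)
transitivity ((1 - x) ^+ 2 - (1 - x ^+ 2) + 2%:R * (x * (1 - x))); last by ring.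
by rewrite -E; ring.
Qed.

Lemma gauss_product n : M n * gauss_sum n = 1.
Proof.
elim: n => [|n IH]; first by rewrite overp_le_series0 /gauss_sum big_ord0 mulr0 addr0 mulr1.
apply: (@fps_cancel _ (1 - fps_X R n.+1)); first by rewrite fpsD fpsN /= subr0.
rewrite mulrA overp_le_seriesS mulrAC gauss_sum_rec -mulrA [gauss_sum n * _]mulrC.
by rewrite IH.
Qed.

Definition fps_one_upto N (f : fps R) := forall i, (i < N)%N -> f i = (i == 0%N)%:R.

Lemma fps_one_uptoM L f g : fps_one_upto L f -> fps_one_upto L g -> fps_one_upto L (f * g).
Proof.
move=> fL gL i iL; rewrite -(fps1 R) -[1 in RHS]mulr1 !fpsM; apply: eq_bigr => j _.
have le_ji : (j <= i)%N by rewrite -ltnS.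
by rewrite fL ?gL // ?(leq_ltn_trans le_ji iL) // (leq_ltn_trans (leq_subr _ _) iL).
Qed.

(** Every factor is 1 - q^i or 1 / (1 - q^i) with i >= n - j + 1. *)
Lemma gauss_coef_one n j : (j <= n)%N -> fps_one_upto (n - j).+1 (gauss_coef n j).
Proof.
have w L L' f : (L <= L')%N -> fps_one_upto L' f -> fps_one_upto L f.
  by move=> LL fL i iL; apply: fL; apply: leq_trans LL.
elim: j => [|j IH] jn; first by move=> i _.
rewrite -subSn // subSS /=; apply: fps_one_uptoM; first apply: fps_one_uptoM.
- by apply: w (IH (ltnW jn)).
- by move=> i iL; rewrite fpsD fpsN fps1 /= (ltn_eqF iL) subr0.
move=> i iL /=; case: i iL => [|i] iL; first by rewrite dvdn0.
by rewrite gtnNdvd //; lia.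
Qed.

(** Replacing the coefficient of q^(j^2) by 1 causes an error starting at exponent j^2 + n - j + 1 >
    n. *)
Lemma gauss_sum_theta n i : (i <= n)%N -> gauss_sum n i = theta_alt R i.
Proof.
move=> le_in; transitivity (\sum_(c <- zrange n | c * c == i%:Z) (-1) ^+ `|c| : R); last first.
  rewrite -[theta_alt R i]/(\sum_(c <- sqroots i) (-1) ^+ `|c|).
  by rewrite (perm_big _ (sqroots_range le_in)) big_filter.
rewrite /gauss_sum fpsD fps_natM fps_sum [RHS]big_mkcond /zrange [RHS]big_cat !big_map.
rewrite -[iota 0 n.+1]/(0%N :: iota 1 n) big_cons [RHS]/=.
have E : \sum_(j <- iota 1 n) (if (- Posz j) * (- Posz j) == i then (-1) ^+ `|- Posz j|%N else 0) =
         \sum_(j <- iota 1 n) (if Posz j * Posz j == i then (-1) ^+ j else 0) :> R.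
  by apply: eq_bigr => j _; rewrite mulrNN abszN.
rewrite E.
have -> : \sum_(j < n) gauss_term n j.+1 i =
   \sum_(j <- iota 1 n) (if Posz j * Posz j == i then (-1) ^+ j else 0) :> R.
  have -> : iota 1 n = [seq (1 + j)%N | j <- index_iota 0 n].
    by rewrite /index_iota subn0 -iotaDl.
  rewrite big_map big_mkord.
  apply: eq_bigr => j _; rewrite /gauss_term -mulrA.
  have -> : ((-1) ^+ j.+1 * (fps_X R (j.+1 * j.+1)%N * gauss_coef n j.+1)) i =
            (-1) ^+ j.+1 * (fps_X R (j.+1 * j.+1)%N * gauss_coef n j.+1) i.
    by elim: (j.+1) (fps_X _ _ * _) => [|k IH] f; rewrite ?expr0 ?mul1r //
      !exprS !mulN1r !mulNr fpsN IH.
  rewrite fps_XM; have [le_ji|lt_ij] := leqP (j.+1 * j.+1)%N i.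
    rewrite gauss_coef_one; [|by have := ltn_ord j; lia |by nia].
    rewrite add1n; have -> : (Posz j.+1 * Posz j.+1 == i) = (i - j.+1 * j.+1 == 0)%N.
      by apply/eqP/eqP; lia.
    by case: ifP => _; rewrite ?mulr1 ?mulr0.
  have -> : (Posz (1 + j) * Posz (1 + j) == i) = false by apply/eqP; lia.
  by rewrite mulr0.
have -> : (1 : fps R) i = (if 0 == i :> int then 1 else 0) :> R by rewrite fps1; case: i {le_in E}.
by rewrite mulr0 expr0 mulr_natl mulr2n addrA.
Qed.

(** Coefficient n of the product only uses indices up to n, where the finite identity
    [gauss_product n] already has the limiting coefficients. *)
Lemma theta_alt_overp_series : theta_alt R * overp_series = 1.
Proof.
rewrite mulrC; apply: fpsP => n; rewrite -(gauss_product n) !fpsM.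
apply: eq_bigr => i _; have le_in : (i <= n)%N by rewrite -ltnS.
by rewrite gauss_sum_theta ?leq_subr //= size_overp_le_seq.
Qed.
End OverpartitionSeries.

(** * Dissections *)

Section Dissection.
Local Open Scope ring_scope.
Variable p : nat.
Hypothesis p_pr : prime p.
Hypothesis p_odd : odd p.
Let a := theta 'F_p.
Let b := theta_alt 'F_p.
Let X := a ^+ 4.
Let Y := b ^+ 4.
Let x := fps_dil 4 a.
Let y := a - x.
Let p0 : p%:R = 0 :> fps 'F_p. Proof. exact: fps_pchar0. Qed.

Let aE : a = x + y. Proof. by rewrite /y; ring. Qed.
Let bE : b = x - y.
Proof.
have := theta_even_part 'F_p; rewrite -/a -/b -/x => E.
have -> : x - y = 2%:R * x - a by rewrite /y; ring.
by rewrite -E; ring.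
Qed.

Let x_supp : fps_supp 4 0 x. Proof. exact: fps_supp_dil. Qed.
Let y_supp8 : fps_supp 8 1 y.
Proof.
move=> n n8; apply: (mulfI (Fp_two_neq0 p_pr p_odd)).
rewrite mulr0 -fps_natM -(theta_odd_part 'F_p n8) -/a -/b; congr (fps_coef _ n).
by rewrite bE aE; ring.
Qed.
Let y_supp : fps_supp 4 1 y.
Proof. by move=> n n4; apply: y_supp8; apply: contra n4 => /eqP E; apply/eqP; lia. Qed.

Let dilX : fps_dil 4 X = x ^+ 4. Proof. by rewrite fps_dilX. Qed.
(** Two mean steps give b(q^4)^4 = a(q^2)^2 a b, and twice this is (a^2 + b^2) a b = 2 (x^2 + y^2)
    (x^2 - y^2). *)
Let dilY : fps_dil 4 Y = x ^+ 4 - y ^+ 4.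
Proof.
apply: (fps_two_lreg p_pr p_odd).
have E1 := theta_agm1 'F_p; have E2 := theta_agm2 (mulfI (Fp_two_neq0 p_pr p_odd)).
rewrite -/a -/b in E1 E2.
have -> : fps_dil 4 Y = fps_dil 2 (a ^+ 2) * (a * b).
  have -> : fps_dil 4 Y = fps_dil 2 (fps_dil 2 Y) by rewrite fps_dil_dil.
  have -> : Y = b ^+ 2 * b ^+ 2 by rewrite /Y; ring.
  rewrite [fps_dil 2 (_ * _)]fps_dilM // -E2.
  have -> : a * b * (a * b) = a ^+ 2 * b ^+ 2 by ring.
  by rewrite fps_dilM // -E2.
by rewrite [LHS]mulrA -E1 aE bE; ring.
Qed.

Let xy_supp : fps_supp 8 0 (x ^+ 4 * (x ^+ 4 - y ^+ 4)).
Proof.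
have E2 := theta_agm2 (mulfI (Fp_two_neq0 p_pr p_odd)); rewrite -/a -/b in E2.
have -> : x ^+ 4 * (x ^+ 4 - y ^+ 4) = fps_dil 4 (X * Y) by rewrite fps_dilM // dilX dilY.
have -> : X * Y = fps_dil 2 (b ^+ 2) ^+ 4 by rewrite -E2 /X /Y; ring.
by rewrite -fps_dilX // fps_dil_dil //; apply: fps_supp_dil.
Qed.

(* As x is supported on exponents = 0 mod 4 and y on exponents = 1 mod 4, the
   monomial y^i x^j only has exponents = i mod 4. *)
Fixpoint form_class (r i : nat) (s : seq nat) : seq nat :=
  match s with
  | [::] => [::]
  | c :: s' => (if i %% 4 == r then c else 0)%N :: form_class r i.+1 s'
  end.

Lemma size_form_class r i s : size (form_class r i s) = size s.
Proof. by elim: s i => //= c s IH i; rewrite IH. Qed.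

Let form_eval_class r s n : (n %% 4 = r)%N ->
  form_eval s y x n = form_eval (form_class r 0 s) y x n.
Proof.
move=> nr; rewrite -[form_eval s _ _]mul1r -[form_eval (form_class _ _ _) _ _]mul1r.
(* The prefix y^i keeps the running index of [form_class] equal to the exponent of y. *)
rewrite -(expr0 y); elim: s 0%N => [//|c s IH] i.
rewrite [form_class _ _ _]/= ![form_eval (_ :: _) _ _]/=.
rewrite !mulrDr !fpsD size_form_class !mulrA -!exprSr IH; congr (_ + _).
have Hs : fps_supp 4 i (y ^+ i * x ^+ size s).
  have := fps_suppM (fps_suppX (k := i) y_supp) (fps_suppX (k := size s) x_supp).
  by rewrite mul1n mul0n addn0.
rewrite ![y ^+ i * _%:R]mulrC -!mulrA !fps_natM; case: eqP => // ir.
by rewrite Hs ?mulr0 //; apply/eqP => E; apply: ir; rewrite -nr.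
Qed.

(* The expansion of l^k t(X, Y) as a form in (y, x), using a = x + y, b = x - y. *)
Definition theta_form (l t : seq nat) (k : nat) : seq nat :=
  form_mul p (form_exp p l k)
    (form_comp p t (form_exp p [:: 1; 1]%N 4) (form_exp p [:: 1; p.-1]%N 4)).

Lemma theta_form_pos : form_eval [:: 1; 1]%N y x = a.
Proof. by rewrite aE /=; ring. Qed.
Lemma theta_form_neg : form_eval [:: 1; p.-1]%N y x = b.
Proof.
have -> : form_eval [:: 1; p.-1]%N y x = x - y + (p.-1%:R + 1) * y by rewrite /=; ring.
by rewrite -mulrSr prednK ?prime_gt0 // p0 mul0r addr0 bE.
Qed.

Let theta_formE l t k : (0 < size l)%N -> (0 < size t)%N ->
  form_eval (theta_form l t k) y x = form_eval l y x ^+ k * form_eval t X Y.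
Proof.
move=> l0 t0; have sE (c : nat) : size (form_exp p [:: 1; c]%N 4) = 5%N.
  by rewrite size_form_exp.
rewrite (form_eval_mul p0) ?size_form_comp ?sE //; last by case: t t0 => // *; rewrite addn1.
by rewrite (form_eval_exp p0) // (form_eval_comp p0) ?sE // !(form_eval_exp p0) // theta_form_pos theta_form_neg.
Qed.

(** Since c5 = -c1 mod p, the class is c1 y x^4 (x^4 - y^4) + c9 y^9, whose exponents are all 1 mod
    8. *)
Lemma theta_form_coef5 l t k c1 c5 c9 n : (0 < size l)%N -> (0 < size t)%N ->
  form_class 1 0 (theta_form l t k) = [:: 0; c1; 0; 0; 0; c5; 0; 0; 0; c9]%N ->
  (c1 + c5 = p)%N ->
  (form_eval l y x ^+ k * form_eval t X Y) (8 * n + 5)%N = 0.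
Proof.
move=> l0 t0 E cp; rewrite -theta_formE // (@form_eval_class 1); last by lia.
rewrite E; set f := form_eval _ _ _.
have -> : f = c1%:R * (y * (x ^+ 4 * (x ^+ 4 - y ^+ 4))) + (c1 + c5)%:R * y ^+ 5 * x ^+ 4
              + c9%:R * y ^+ 9 by rewrite /f /= natrD; ring.
rewrite cp p0 !mul0r addr0 fpsD !fps_natM.
rewrite (fps_suppM y_supp8 xy_supp) ?(fps_suppX (k := 9) y_supp8) ?mulr0 ?addr0 //; apply/eqP; lia.
Qed.

(** Likewise c3 y^3 x^4 (x^4 - y^4) + c11 y^11 only has exponents 3 mod 8. *)
Lemma theta_form_coef7 l t k c3 c7 c11 n : (0 < size l)%N -> (0 < size t)%N ->
  form_class 3 0 (theta_form l t k) = [:: 0; 0; 0; c3; 0; 0; 0; c7; 0; 0; 0; c11]%N ->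
  (c3 + c7 = p)%N ->
  (form_eval l y x ^+ k * form_eval t X Y) (8 * n + 7)%N = 0.
Proof.
move=> l0 t0 E cp; rewrite -theta_formE // (@form_eval_class 3); last by lia.
rewrite E; set f := form_eval _ _ _.
have -> : f = c3%:R * (y ^+ 3 * (x ^+ 4 * (x ^+ 4 - y ^+ 4)))
   + (c3 + c7)%:R * y ^+ 7 * x ^+ 4 + c11%:R * y ^+ 11 by rewrite /f /= natrD; ring.
rewrite cp p0 !mul0r addr0 fpsD !fps_natM.
rewrite (fps_suppM (fps_suppX (k := 3) y_supp8) xy_supp) ?(fps_suppX (k := 11) y_supp8) ?mulr0 ?addr0 //; apply/eqP; lia.
Qed.

(** The class is x^3 (c0 x^8 + c4 x^4 y^4 + c8 y^8); substituting x^4 = X(q^4) and y^4 = X(q^4) -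
    Y(q^4) yields [t']. *)
Lemma theta_form_coef4 l t t' c0 c4 c8 n : (0 < size l)%N -> (0 < size t)%N ->
  form_class 0 0 (theta_form l t 3) = [:: c0; 0; 0; 0; c4; 0; 0; 0; c8; 0; 0; 0]%N ->
  t' = [:: c8; (p.-1 * (c4 + 2 * c8)) %% p; (c0 + c4 + c8) %% p]%N ->
  (form_eval l y x ^+ 3 * form_eval t X Y) (4 * n)%N =
  (form_eval [:: 1; 1]%N y x ^+ 3 * form_eval t' X Y) n.
Proof.
move=> l0 t0 E ->; rewrite -theta_formE // (@form_eval_class 0); last by lia.
rewrite E -[RHS](@fps_dil_mul _ 4) //; congr (fps_coef _ (4 * n)%N).
rewrite fps_dilM // fps_dilX // theta_form_pos -/x fps_dil_form // dilX dilY.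
rewrite /= !(natr_modp p0) !natrD [(p.-1 * _)%:R]natrM natrD [(2 * c8)%:R]natrM.
have -> : p.-1%:R = -1 :> fps 'F_p.
  by apply/eqP; rewrite -subr_eq0 opprK -mulrSr prednK ?prime_gt0 // p0.
by ring.
Qed.
End Dissection.

(** * The congruences modulo 11 and 13 *)

Section Congruences.
Local Open Scope ring_scope.

Lemma overpartn_mod p n : prime p -> overp_series 'F_p n = 0 -> (overpartn n %% p = 0)%N.
Proof.
by move=> p_pr /= /eqP; rewrite -(dvdn_pcharf (pchar_Fp p_pr)) => /eqP.
Qed.

Lemma overp_series_mod11 n : overp_series 'F_11 (11 * n)%N =
  (theta_alt 'F_11 ^+ 5 *
   form_eval [:: 10; 2]%N (theta 'F_11 ^+ 4) (theta_alt 'F_11 ^+ 4)) n.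
Proof.
set a := theta _; set b := theta_alt _.
have E : b ^+ 10 = b ^+ 2 * form_eval [:: 1; 0; 0]%N (a ^+ 4) (b ^+ 4) by rewrite /=; ring.
(* [h] is minus the sum of binom(5, i)^2 x^i y^(5-i) mod 11. The exponents [k1] and [k2] bring both
   sides of [check] to degree 62, and [e] comes from 6 * 11 = 2 + 4 * 16. *)
by apply: (overpartition_progression (p := 11) isT isT (theta_alt_overp_series _)
    (h := [:: 10; 8; 10; 10; 8; 10]%N) isT _ _ _ (e := 16) (k1 := 12) (k2 := 7)
    (r := 2) (r' := 5) (s0 := [:: 1; 0; 0]%N) (g := [:: 10; 2]%N)
    isT isT E); vm_compute.
Qed.

Lemma overp_series_mod13 n : overp_series 'F_13 (13 * n)%N =
  (theta_alt 'F_13 ^+ 3 *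
   form_eval [:: 1; 10; 3]%N (theta 'F_13 ^+ 4) (theta_alt 'F_13 ^+ 4)) n.
Proof.
set a := theta _; set b := theta_alt _.
have E : b ^+ 12 = b ^+ 0 * form_eval [:: 1; 0; 0; 0]%N (a ^+ 4) (b ^+ 4) by rewrite /=; ring.
(* [h] is the sum of binom(6, i)^2 x^i y^(6-i) mod 13; the common degree is 87, and 4 * 13 = 4 * 13
   + 0 gives [e]. *)
by apply: (overpartition_progression (p := 13) isT isT (theta_alt_overp_series _)
    (h := [:: 1; 10; 4; 10; 4; 10; 1]%N) isT _ _ _ (e := 13) (k1 := 14) (k2 := 8)
    (r := 0) (r' := 3) (s0 := [:: 1; 0; 0; 0]%N) (g := [:: 1; 10; 3]%N)
    isT isT E); vm_compute.
Qed.
End Congruences.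

Theorem mainTheorem1 :
  forall n : nat,
    overpartn (11 * (8 * n + 5)) %% 11 = 0 /\
    overpartn (13 * 2 ^ 6 * (8 * n + 7)) %% 13 = 0.
Proof.
move=> n; split; apply: overpartn_mod => //.
  have := theta_form_coef5 (p := 11) (l := [:: 1; 10]) (t := [:: 10; 2]) (k := 5)
    (c1 := 7) (c5 := 4) (c9 := 10) isT isT n isT isT erefl erefl.
  by rewrite overp_series_mod11 theta_form_neg.
(* Each factor 4 of 2^6 is one extraction by [theta_form_coef4]: the first turns the b^3 form into
   an a^3 form, and the next two preserve that shape. *)
have -> : 13 * 2 ^ 6 * (8 * n + 7) = 13 * (4 * (4 * (4 * (8 * n + 7)))) by lia.
have := theta_form_coef4 (p := 13) (l := [:: 1; 12]) (t := [:: 1; 10; 3]) (t' := [:: 5; 7; 2])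
  (c0 := 1) (c4 := 9) (c8 := 5) isT isT (4 * (4 * (8 * n + 7))) isT isT erefl erefl.
rewrite overp_series_mod13 theta_form_neg // => ->.
rewrite (theta_form_coef4 (p := 13) (t' := [:: 5; 2; 7]) (c0 := 1) (c4 := 1) (c8 := 5) isT isT) //.
rewrite (theta_form_coef4 (p := 13) (t' := [:: 1; 7; 6]) (c0 := 1) (c4 := 4) (c8 := 1) isT isT) //.
by rewrite (theta_form_coef7 (p := 13) (c3 := 8) (c7 := 5) (c11 := 1) isT isT).
Qed.
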